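(* For each finite ordered alphabet $\mathbb A$ and each symmetric cyclic Abelian class $\mathfrak X$ over $\mathbb A$ we have $|\mathcal U(\mathfrak X)|=1$. In particular, if $\mathbb A\subseteq\{2,3,4,\ldots\}$ (with the usual order), then each cyclic Abelian class $\mathcal C$ over $\mathbb A$ contains a unique (up to reversal) cyclic word $\omega$ with the property that $\dot K^{\circlearrowright}(\omega)=\min\{\dot K^{\circlearrowright}(\nu):\nu\in\mathcal C\}$.
   Context: Words: $\mathbb A^+$ (resp. $\mathbb A^*$) is the set of non-empty (resp. all) finite words over the finite non-empty totally ordered alphabet $\mathbb A$. For $x=x_1\cdots x_n$ put $x^*=x_n\cdots x_1$. A cyclic word over $\mathbb A$ is an equivalence class of $\mathbb A^+$ under $w\sim w'$ iff $w=pq$, $w'=qp$ for some $p,q\in\mathbb A^*$. ''$\omega=uv$'' means that $uv$ belongs to the class $\omega$. The reversal $\omega^*$ is the class of $x^*$ for any $x$ in $\omega$, and $\bar\omega=\{\omega,\omega^*\}$. A cyclic Abelian class $\mathcal C$ is the set of all cyclic words over $\mathbb A$ having a prescribed non-zero Parikh vector (number of occurrences of each letter); the corresponding symmetric cyclic Abelian class is $\mathfrak X=\{\bar\omega:\omega\in\mathcal C\}$. Order (for words of equal length): if $x\ne y$ have equal length and $i$ is the first index with $x_i\neq y_i$, then $x\prec y$ iff $x_i<y_i$. A factorization $\omega=uv$ with $u,v\in\mathbb A^+$, $u\neq u^*$, $v\neq v^*$ is synchronizing if ($u\prec u^*\iff v\prec v^*$). $\mathcal U(\mathcal C)$ is the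 set of $\omega\in\mathcal C$ such that no factorization $\omega=uv$ with $u\neq u^*$, $v\neq v^*$ is synchronizing, and $\mathcal U(\mathfrak X)=\{\bar\omega:\omega\in\mathcal U(\mathcal C)\}$. Semi-regular continuant: $\dot K()=1$, $\dot K(x_1)=x_1$, $\dot K(x_1\cdots x_n)=x_n\dot K(x_1\cdots x_{n-1})-\dot K(x_1\cdots x_{n-2})$. Cyclic version: $\dot K^{\circlearrowright}(x_1\cdots x_n)=\dot K(x_1\cdots x_n)-\dot K(x_2\cdots x_{n-1})$ for $n\ge2$ (for $n=1$ it is taken to be $x_1$). It is invariant under cyclic conjugation, hence well defined on cyclic words. *)

(* Defs.v *)
From HB Require Import structures.
From mathcomp Require Import all_boot all_order all_algebra.
From mathcomp Require Import finmap ring.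
From mathcomp Require Import boolp classical_sets functions cardinality.

Set Implicit Arguments.
Unset Strict Implicit.
Unset Printing Implicit Defensive.

Import Order.TTheory GRing.Theory Num.Theory.

Local Open Scope classical_set_scope.
Local Open Scope quotient_scope.

Section Words.
Context {d : Order.disp_t} {A : finOrderType d}.

Definition word : Type := {w : seq A | w != [::]}.

Fact cat_word_subproof (u v : word) : val u ++ val v != [::].
Proof. by case: u => -[]. Qed.

Definition cat_word (u v : word) : word :=
  exist (fun s : seq A => s != [::]) _ (cat_word_subproof u v).

Fact rev_word_subproof (w : word) : rev (val w) != [::].
Proof. by rewrite -size_eq0 size_rev size_eq0 (valP w). Qed.

Definition rev_word (w : word) : word :=
  exist (fun s : seq A => s != [::]) _ (rev_word_subproof w).

(* [seqlexi] is the lexicographic order on sequences of arbitrary lengths; it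
   is only used here on words of equal length. *)
Definition lex_lt (u v : word) : Prop :=
  ((val u : seqlexi A) < (val v : seqlexi A))%O.

Definition conjugate (w w' : word) : bool :=
  `[< exists p q : seq A, val w = p ++ q /\ val w' = q ++ p >].

Lemma conjugateP (w w' : word) :
  reflect (exists n, val w' = rot n (val w)) (conjugate w w').
Proof.
apply: (iffP (asboolP _)) => [[p [q [-> ->]]]|[n ->]].
  by exists (size p); rewrite rot_size_cat.
by exists (take n (val w)), (drop n (val w)); rewrite cat_take_drop.
Qed.

Lemma conjugate_refl : reflexive conjugate.
Proof. by move=> w; apply/conjugateP; exists 0; rewrite rot0. Qed.

Lemma conjugate_sym : symmetric conjugate.
Proof.
suff sub w w' : conjugate w w' -> conjugate w' w.
  by move=> w w'; apply/idP/idP; apply: sub.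
by move=> /asboolP[p [q [e e']]]; apply/asboolP; exists q, p.
Qed.

Lemma conjugate_trans : transitive conjugate.
Proof.
move=> v u w /conjugateP[m em] /conjugateP[n en]; apply/conjugateP.
have [k _ ek] : {k | k <= size (val u) & rot n (rot m (val u)) = rot k (val u)}.
  have [hm|hm] := leqP m (size (val u)); last first.
    rewrite [rot m _]rot_oversize; last exact: ltnW.
    have [hn|hn] := leqP n (size (val u)); first by exists n.
    by exists 0 => //; rewrite rot0 rot_oversize // ltnW.
  have [hn|hn] := leqP n (size (val u)).
    by rewrite rot_add_mod //; case: ifP => h; eexists; try reflexivity;
       rewrite ?leq_subLR // leq_add.
  by exists m => //; rewrite rot_oversize // size_rot ltnW.
by exists k; rewrite en em.
Qed.

Canonical conjugate_equiv :=
  EquivRel conjugate conjugate_refl conjugate_sym conjugate_trans.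

Definition cyclic_word : Type := {eq_quot conjugate_equiv}.

Definition cyc (w : word) : cyclic_word := \pi_({eq_quot conjugate_equiv}) w.

Definition cyc_repr (x : cyclic_word) : word :=
  repr (x : {eq_quot conjugate_equiv}).

Lemma cyc_reprK (x : cyclic_word) : cyc (cyc_repr x) = x.
Proof. exact: (@reprK _ {eq_quot conjugate_equiv}). Qed.

Lemma cycP (w w' : word) : (cyc w = cyc w') <-> conjugate w w'.
Proof. by split=> [/eqmodP|h]; last apply/eqmodP. Qed.

Lemma conjugate_repr (w : word) : conjugate w (cyc_repr (cyc w)).
Proof. by apply/cycP; rewrite cyc_reprK. Qed.

Definition cyc_rev (x : cyclic_word) : cyclic_word := cyc (rev_word (cyc_repr x)).

Lemma cyc_revE (w : word) : cyc_rev (cyc w) = cyc (rev_word w).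
Proof.
apply/cycP; have := conjugate_repr w; rewrite conjugate_sym.
move=> /asboolP[p [q [e e']]]; apply/asboolP; exists (rev q), (rev p).
by rewrite /= e e' !rev_cat.
Qed.

Lemma cyc_revK : involutive cyc_rev.
Proof.
move=> x; rewrite -(cyc_reprK x) !cyc_revE; congr cyc.
by apply: val_inj; rewrite /= revK.
Qed.

Definition parikh (x : cyclic_word) : A -> nat :=
  fun a => count_mem a (val (cyc_repr x)).

Lemma parikhE (w : word) (a : A) : parikh (cyc w) a = count_mem a (val w).
Proof.
have /conjugateP[n en] := conjugate_repr w.
by rewrite /parikh en /rot count_cat addnC -count_cat cat_take_drop.
Qed.

Lemma parikh_rev (x : cyclic_word) : parikh (cyc_rev x) = parikh x.
Proof.
apply/funext => a; rewrite -(cyc_reprK x) cyc_revE !parikhE /=.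
exact: count_rev.
Qed.

Definition cyclic_abelian_class (C : set cyclic_word) : Prop :=
  exists p : A -> nat, (exists a, p a <> 0) /\ C = [set x | parikh x = p].

Definition bar (x : cyclic_word) : set cyclic_word := [set x; cyc_rev x].

Definition symmetric_cyclic_abelian_class (X : set (set cyclic_word)) : Prop :=
  exists C, cyclic_abelian_class C /\ X = [set bar x | x in C].

Definition synchronizing (u v : word) : Prop :=
  lex_lt u (rev_word u) <-> lex_lt v (rev_word v).

Definition unsync (C : set cyclic_word) : set cyclic_word :=
  [set x | C x /\ forall u v : word, x = cyc (cat_word u v) ->
     u <> rev_word u -> v <> rev_word v -> ~ synchronizing u v].

(* The class C underlying X = { bar x : x in C } is the union of X;
   see [cover_bar] and [unsync_symE]. *)
Definition unsync_sym (X : set (set cyclic_word)) : set (set cyclic_word) :=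
  [set bar x | x in unsync (\bigcup_(W in X) W)].

Lemma cover_bar (C : set cyclic_word) :
  cyclic_abelian_class C -> \bigcup_(W in [set bar x | x in C]) W = C.
Proof.
move=> [p [_ ->]]; apply/seteqP; split=> x /=; last first.
  by move=> px; exists (bar x) => /=; [exists x | left].
by move=> [_ [y /= py <-]] [->|->] //; rewrite parikh_rev.
Qed.

Lemma unsync_symE (C : set cyclic_word) : cyclic_abelian_class C ->
  unsync_sym [set bar x | x in C] = [set bar x | x in unsync C].
Proof. by move=> hC; rewrite /unsync_sym cover_bar. Qed.

End Words.

Arguments word {d} A.
Arguments cyclic_word {d} A.

HB.instance Definition _ (S : {fset nat}) := [Order of S by <:].

Section Continuants.
Local Open Scope ring_scope.

(* The recurrence peels letters off the end of the word, hence the reversal. *)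
Fixpoint continuant_rev (s : seq int) : int :=
  match s with
  | [::] => 1
  | x :: s' =>
      match s' with
      | [::] => x
      | _ :: s'' => x * continuant_rev s' - continuant_rev s''
      end
  end.

Definition continuant (s : seq int) : int := continuant_rev (rev s).

(* [belast y s] is y :: s without its last letter. The value at [::] is junk. *)
Definition cyclic_continuant_seq (s : seq int) : int :=
  match s with
  | [::] => 0
  | [:: x] => x
  | x :: y :: s' => continuant s - continuant (belast y s')
  end.

Definition letters (S : {fset nat}) (w : word S) : seq int :=
  [seq (val a)%:Z | a <- val w].

Definition cyclic_continuant (S : {fset nat}) (x : cyclic_word S) : int :=
  cyclic_continuant_seq (letters (cyc_repr x)).

Lemma continuant_rcons (s : seq int) (y x : int) :
  continuant (rcons (rcons s y) x) =
  x * continuant (rcons s y) - continuant s.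
Proof. by rewrite /continuant !rev_rcons. Qed.

Lemma continuant_cons (x y : int) (s : seq int) :
  continuant [:: x, y & s] = x * continuant (y :: s) - continuant s.
Proof.
have [n] := ubnP (size s); elim: n => // n IH in s *.
case/lastP: s => [|s z]; first by move=> _; rewrite /continuant /rev /=; ring.
rewrite size_rcons ltnS => sn.
rewrite -!rcons_cons; case/lastP: s => [|s t] in sn *.
  by rewrite /continuant /rev /=; ring.
rewrite -!rcons_cons !continuant_rcons !rcons_cons !IH //.
  by rewrite size_rcons in sn; ring.
by rewrite size_rcons in sn; apply: leq_trans sn.
Qed.

Lemma cyclic_continuant_rot1 (s : seq int) :
  cyclic_continuant_seq (rot 1 s) = cyclic_continuant_seq s.
Proof.
case: s => [//|x [//|y s]]; rewrite rot1_cons.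
case/lastP: s => [|t z]; first by rewrite /= /continuant /rev /=; ring.
have e : rcons (y :: rcons t z) x = y :: rcons (rcons t z) x by [].
rewrite e /cyclic_continuant_seq; case E: (rcons (rcons t z) x) => [|a l].
  by move/(congr1 size): E; rewrite size_rcons.
have -> : belast a l = rcons t z.
  have := E; rewrite lastI => /eqP; rewrite eqseq_rcons.
  by move=> /andP[/eqP <- _].
rewrite -E continuant_cons belast_rcons -!rcons_cons continuant_rcons; ring.
Qed.

Lemma cyclic_continuantE (S : {fset nat}) (w : word S) :
  cyclic_continuant (cyc w) = cyclic_continuant_seq (letters w).
Proof.
have /conjugateP[n en] := conjugate_repr w.
rewrite /cyclic_continuant /letters en map_rot.
elim: n {en} => [|n IH]; first by rewrite rot0.
have [hn|hn] := leqP n.+1 (size [seq (val a)%:Z | a <- val w]).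
  by rewrite -add1n rotD // cyclic_continuant_rot1.
by rewrite rot_oversize // ltnW.
Qed.

Definition is_minimizer (S : {fset nat}) (C : set (cyclic_word S))
    (x : cyclic_word S) : Prop :=
  C x /\ forall y, C y -> cyclic_continuant x <= cyclic_continuant y.

End Continuants.

(* Main.v *)
Require Import Defs.
From mathcomp Require Import all_boot all_order all_algebra.
From mathcomp Require Import finmap.
From mathcomp Require Import boolp classical_sets functions cardinality.
From mathcomp Require Import ring zify.
Import Order.TTheory GRing.Theory Num.Theory.
Local Open Scope classical_set_scope.
Local Open Scope card_scope.

(* Uniqueness. A cyclic word without synchronizing factorization is an organ
   pipe: its letters, taken in increasing order, extend on either side a factor
   [p] that always consists of the smallest letters.  Write the word as [p w]
   with [p] larger than or equal to its reversal.  If the least letter [b] of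
   [w] were not next to [p] on the right (or on the left, when [p] is a
   palindrome), then [p], [w] or [p y], [b z] with [w = y b z] would be
   synchronizing.

   Existence. The cyclic continuant of [w] is the trace of a product of 2x2
   matrices, and replacing [u] by its reversal in [u v] lowers it by
   [skew u * skew v], where [skew u] has the sign of the comparison of [u] with
   its reversal as soon as all letters are at least 2.  So the minimizers of the
   cyclic continuant have no synchronizing factorization; for an abstract
   alphabet, map the letters increasingly to integers that are at least 2. *)

(** * Cyclic words without synchronizing factorization *)

Section OrganPipe.
Set Implicit Arguments.
Unset Strict Implicit.
Context {d : Order.disp_t} {A : finOrderType d}.
Implicit Types (s t u v w p : seq A) (x y : cyclic_word A).

Local Notation "s <l t" := ((s : seqlexi A) < (t : seqlexi A))%O (at level 70).
Local Notation "s <=l t" := ((s : seqlexi A) <= (t : seqlexi A))%O (at level 70).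

Lemma lexi_rcons s t (a : A) : size s = size t ->
  (rcons s a <l rcons t a) = (s <l t).
Proof.
elim: s t => [|b s IH] [|c t] //= [e].
by rewrite !Order.SeqLexiOrder.ltxi_cons IH.
Qed.

Lemma lexi_headlt (a b : A) s t : (a < b)%O -> (a :: s) <l (b :: t).
Proof. by move=> ab; rewrite Order.SeqLexiOrder.ltxi_cons ltW //= leNgt ab. Qed.

(** Relational, so that plain sequences can be cut, rotated and reversed without carrying proofs of
    non-emptiness. *)
Definition spells s x := exists w : word A, val w = s /\ cyc w = x.

Lemma spells_inj s x y : spells s x -> spells s y -> x = y.
Proof.
by move=> [w [ws <-]] [w' [w's <-]]; congr cyc; apply: val_inj; rewrite ws.
Qed.

Lemma spells_rot s t x : spells (s ++ t) x -> spells (t ++ s) x.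
Proof.
move=> [[w w0] /= [e <-]]; subst w.
have ts0 : t ++ s != [::].
  by move: w0; rewrite -!size_eq0 !size_cat addnC.
exists (exist (fun s : seq A => s != [::]) (t ++ s) ts0); split=> //.
by apply/cycP/asboolP; exists t, s.
Qed.

Lemma spells_rev s x : spells s x -> spells (rev s) (cyc_rev x).
Proof. by move=> [w [<- <-]]; exists (rev_word w); rewrite cyc_revE. Qed.

Definition desync x := forall u v : word A, x = cyc (cat_word u v) ->
  u <> rev_word u -> v <> rev_word v -> ~ synchronizing u v.

(** Reversal exchanges the two factors and flips both comparisons, so synchronization is
    preserved. *)
Lemma desync_rev x : desync x -> desync (cyc_rev x).
Proof.
move=> dx u v xuv nu nv sync.
have e : x = cyc (cat_word (rev_word v) (rev_word u)).
  rewrite -[x]cyc_revK xuv cyc_revE; congr cyc; apply: val_inj.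
  by rewrite /= rev_cat.
have revwK (w : word A) : rev_word (rev_word w) = w.
  by apply: val_inj; rewrite /= revK.
apply: (dx _ _ e) => [vE|uE|]; first by move: vE; rewrite revwK => /esym.
  by move: uE; rewrite revwK => /esym.
have gtw (w : word A) : w <> rev_word w ->
    lex_lt (rev_word w) (rev_word (rev_word w)) <-> ~ lex_lt w (rev_word w).
  move=> nw; rewrite revwK /lex_lt; case: ltgtP => [_|_|wE]; [by split|by split|].
  by case: nw; apply: val_inj.
have := gtw u nu; have := gtw v nv; move: sync; rewrite /synchronizing; tauto.
Qed.

Lemma desync_lt x u v : desync x -> spells (u ++ v) x ->
  u <l rev u -> v <l rev v -> False.
Proof.
move=> dx [w [wE xE]] ltu ltv; subst x.
have u0 : u != [::] by apply: contraTneq ltu => ->; rewrite ltxx.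
have v0 : v != [::] by apply: contraTneq ltv => ->; rewrite ltxx.
pose U : word A := exist (fun s : seq A => s != [::]) u u0.
pose V : word A := exist (fun s : seq A => s != [::]) v v0.
have neq (W : word A) : lex_lt W (rev_word W) -> W <> rev_word W.
  by rewrite /lex_lt => + WE; rewrite -WE ltxx.
have wUV : cyc w = cyc (cat_word U V) by congr cyc; apply: val_inj.
by apply: (dx _ _ wUV); [apply: (neq U)|apply: (neq V)|].
Qed.

Lemma desync_gt x u v : desync x -> spells (u ++ v) x ->
  rev u <l u -> rev v <l v -> False.
Proof.
move=> dx xuv ltu ltv; apply: (@desync_lt (cyc_rev x) (rev v) (rev u)).
- exact: desync_rev.
- by rewrite -rev_cat; apply: spells_rev.
- by rewrite revK.
- by rewrite revK.
Qed.

(* If both ends of [w] exceed its least letter [b], cut [w = y ++ b :: z] at the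
   first [b]: then [p ++ y] and [b :: z] start with a smaller letter than
   they end with. *)
Lemma desync_next x p w (b : A) : desync x -> spells (p ++ w) x ->
  p <> [::] -> rev p <=l p -> {in p, forall a, a <= b}%O ->
  b \in w -> {in w, forall a, b <= a}%O ->
  head b w = b \/ (p = rev p /\ last b w = b).
Proof.
move=> dx xpw p0 lep pb bw wb.
have [->|hwb] := eqVneq (head b w) b; [by left|right].
have w0 : w != [::] by apply: contraTneq bw => ->.
have pE : p = rev p \/ w <=l rev w.
  have [pE|np] := eqVneq p (rev p); first by left.
  right; rewrite leNgt; apply/negP => /(@desync_gt x p w dx xpw); apply.
  by rewrite lt_neqAle eq_sym np.
have [lw|lwb] := eqVneq (last b w) b.
  (* Here [w] starts above [b] and ends with [b], so it exceeds its reversal; only the palindrome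
     alternative of [pE] remains. *)
  split=> //; case: pE => // lew; exfalso; move: lew; apply/negP.
  case: w w0 hwb wb lw {bw xpw} => //= c w _ cb; case/lastP: w => [|w e] wb.
    by move=> /eqP; rewrite (negPf cb).
  rewrite last_rcons => ->; rewrite -ltNge -rcons_cons rev_rcons.
  by apply: lexi_headlt; rewrite lt_neqAle eq_sym cb wb ?mem_head.
exfalso; have hb : has (pred1 b) w by rewrite has_pred1.
move: hwb lwb wb xpw {bw w0 pE}.
case/split_find: hb => c y z /eqP->; rewrite has_pred1 => nby.
case/lastP: y nby => [|y e]; first by rewrite /= eqxx.
rewrite mem_rcons inE negb_or => /andP[be _] _.
case/lastP: z => [|z f]; first by rewrite cats0 last_rcons eqxx.
rewrite last_cat last_rcons => fb wb.
rewrite cat_rcons catA => xpw.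
apply: (desync_lt dx xpw).
  rewrite -rcons_cat rev_rcons; case: p p0 pb {lep xpw} => // a p _ pb.
  rewrite rcons_cons; apply: lexi_headlt; apply: (@le_lt_trans _ _ b).
    by rewrite pb ?mem_head.
  by rewrite lt_neqAle be wb // !(mem_cat, mem_rcons, inE) eqxx ?orbT.
rewrite -rcons_cons rev_rcons; apply: lexi_headlt.
by rewrite lt_neqAle eq_sym fb wb // !(mem_cat, mem_rcons, inE) eqxx ?orbT.
Qed.

(** The test keeps the block at least as large as its reversal, the orientation required by
    [desync_next]. *)
Definition pipe_step p (b : A) : seq A :=
  let q := rcons p b in if rev q <=l q then q else rev q.

Definition pipe s : seq A :=
  if s is a :: t then foldl pipe_step [:: a] t else [::].

Lemma sort_min s t (b : A) : perm_eq s (b :: t) -> {in s, forall a, b <= a}%O ->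
  sort <=%O s = b :: sort <=%O t.
Proof.
move=> st bs; apply: le_sorted_eq => //=.
- exact: sort_le_sorted.
- rewrite (path_sortedE le_trans) sort_le_sorted andbT all_sort.
  by apply/allP => a ta; apply: bs; rewrite (perm_mem st) inE ta orbT.
- by rewrite perm_sort (perm_trans st) // perm_cons perm_sym perm_sort.
Qed.

(** By [desync_next] the least remaining letter is adjacent to [p] and can join the block. The
    resulting block depends on the letters alone; only the orientation of [x] stays open. *)
Lemma desync_foldl x p w : desync x -> spells (p ++ w) x ->
  p <> [::] -> rev p <=l p -> {in p & w, forall a b, a <= b}%O ->
  let q := foldl pipe_step p (sort <=%O w) in
  spells q x \/ spells q (cyc_rev x).
Proof.
have [n] := ubnP (size w); elim: n => // n IH in x p w *.
case E: (sort <=%O w) => [|b t] wn dx xpw p0 lep pw /=.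
  move/(congr1 size): E; rewrite size_sort => /size0nil w0.
  by left; rewrite w0 cats0 in xpw.
have wb : {in w, forall a, b <= a}%O.
  move=> a; rewrite -(mem_sort <=%O) E inE => /predU1P[->//|].
  by apply/allP/(order_path_min le_trans); have := sort_le_sorted w; rewrite E.
have bw : b \in w by rewrite -(mem_sort <=%O) E mem_head.
have pb : {in p, forall a, a <= b}%O by move=> a pa; apply: pw.
(* The case of [b] on the right of [p], for any [x'], since the other case applies it to the
   reversed cyclic word. *)
have step x' w' : perm_eq w (b :: w') -> desync x' -> spells (p ++ b :: w') x' ->
    let q := foldl pipe_step (pipe_step p b) t in
    spells q x' \/ spells q (cyc_rev x').
  move=> ww' dx' xpw'.
  have tE : t = sort <=%O w' by have := sort_min ww' wb; rewrite E => -[].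
  have w'n : size w' < n.
    by move: wn; rewrite (perm_size ww') /= ltnS.
  have pbw' : {in rcons p b & w', forall a c, a <= c}%O.
    move=> a c; rewrite mem_rcons inE => /predU1P[->|pa] w'c.
      by apply: wb; rewrite (perm_mem ww') inE w'c orbT.
    by apply: pw => //; rewrite (perm_mem ww') inE w'c orbT.
  rewrite /pipe_step tE; case: ifPn => [leq|].
    by apply: IH; rewrite ?cat_rcons //; case: (p).
  rewrite -ltNge => ltq; have -> : sort <=%O w' = sort <=%O (rev w').
    by apply/perm_sort_leP; rewrite perm_sym perm_rev.
  rewrite or_comm -{2}[x']cyc_revK; apply: IH.
  - by rewrite size_rev.
  - exact: desync_rev.
  - by apply: spells_rot; rewrite -rev_cat; apply: spells_rev; rewrite cat_rcons.
  - by rewrite rev_rcons.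
  - by rewrite revK ltW.
  - by move=> a c; rewrite !mem_rev; apply: pbw'.
have [hw|[pE lw]] := @desync_next x p w b dx xpw p0 lep pb bw wb.
  case: w hw xpw bw {E wb pw wn} step => //= c w -> xpw _ step.
  by apply: step xpw => //.
(* Now [b] precedes the palindrome [p]; read backwards, it follows the same [p]. *)
case/lastP: w lw xpw bw {E wb pw wn} step => //= w c.
rewrite last_rcons => -> xpw _ step.
rewrite or_comm -{2}[x]cyc_revK; apply: (step (cyc_rev x) (rev w)).
- by rewrite perm_rcons perm_cons perm_sym perm_rev.
- exact: desync_rev.
- rewrite pE; apply: spells_rot; rewrite -rev_rcons -rev_cat.
  exact: spells_rev.
Qed.

Lemma desync_pipe x s : desync x -> spells s x ->
  let q := pipe (sort <=%O s) in spells q x \/ spells q (cyc_rev x).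
Proof.
case E: (sort <=%O s) => [|b t] dx xs.
  move/(congr1 size): E; rewrite size_sort => /size0nil s0.
  by left; rewrite s0 in xs.
have bs : b \in s by rewrite -(mem_sort <=%O) E mem_head.
have sb : {in s, forall a, b <= a}%O.
  move=> a; rewrite -(mem_sort <=%O) E inE => /predU1P[->//|].
  by apply/allP/(order_path_min le_trans); have := sort_le_sorted s; rewrite E.
case/splitPr: s / bs E xs sb => s1 s2 E /spells_rot xs sb.
have st : perm_eq (s1 ++ b :: s2) (b :: s2 ++ s1) by rewrite perm_catC.
have := sort_min st sb; rewrite E => -[->]; apply: desync_foldl => //.
move=> a c; rewrite inE => /eqP-> cs; apply: sb.
by rewrite (perm_mem st) inE cs orbT.
Qed.

(** Equal Parikh vectors give equal sorted words, hence the same [pipe], which spells both [x] and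
    [y] up to reversal. *)
Lemma desync_unique x y : desync x -> desync y -> parikh x = parikh y ->
  bar x = bar y.
Proof.
rewrite -(cyc_reprK x) -(cyc_reprK y).
set u := cyc_repr x; set v := cyc_repr y => du dv puv.
have uv : sort <=%O (val u) = sort <=%O (val v).
  apply/perm_sort_leP/allP => a _ /=.
  by have := congr1 (@^~ a) puv; rewrite !parikhE => /eqP.
have := @desync_pipe _ (val v) dv; have := @desync_pipe _ (val u) du.
have sp (w : word A) : spells (val w) (cyc w) by exists w.
rewrite uv => /(_ (sp u)) hu /(_ (sp v)) hv.
have barR z : bar (cyc_rev z) = bar z by rewrite /bar cyc_revK setUC.
case: hu hv => [hu|hu] [hv|hv]; have := spells_inj hu hv.
- by move=> ->.
- by move=> ->; rewrite barR.
- by move=> <-; rewrite barR.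
- by move=> e; rewrite -barR e barR.
Qed.
End OrganPipe.

(** * Continuants as entries and traces of matrix products *)

Section ContinuantMatrix.
Set Implicit Arguments.
Unset Strict Implicit.
Local Open Scope ring_scope.
Implicit Types (s : seq int).

Definition mat2 (a b c e : int) : 'M[int]_2 :=
  \matrix_(i, j) if i == 0 then (if j == 0 then a else b)
                 else (if j == 0 then c else e).

Lemma mulmx2E (M N : 'M[int]_2) i j :
  (M *m N) i j = M i 0 * N 0 j + M i 1 * N 1 j.
Proof.
rewrite mxE big_ord_recl big_ord1.
by congr (_ + M i _ * N _ j); apply: val_inj.
Qed.

Lemma mxtrace2 (M : 'M[int]_2) : \tr M = M 0 0 + M 1 1.
Proof.
by rewrite /mxtrace big_ord_recl big_ord1; congr (_ + M _ _); apply: val_inj.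
Qed.

Definition letter_mx (a : int) : 'M[int]_2 := mat2 a (-1) 1 0.

Definition word_mx s : 'M[int]_2 := foldr (fun a M => letter_mx a *m M) 1%:M s.

Lemma word_mx_cat s t : word_mx (s ++ t) = word_mx s *m word_mx t.
Proof. by elim: s => [|a s IH] /=; rewrite ?mul1mx // IH mulmxA. Qed.

Lemma word_mx_rcons s a : word_mx (rcons s a) = word_mx s *m letter_mx a.
Proof. by rewrite -cats1 word_mx_cat /= mulmx1. Qed.

Lemma word_mx_consE a s :
  (word_mx (a :: s) 0 0 = a * word_mx s 0 0 - word_mx s 1 0) *
  (word_mx (a :: s) 0 1 = a * word_mx s 0 1 - word_mx s 1 1) *
  (word_mx (a :: s) 1 0 = word_mx s 0 0) *
  (word_mx (a :: s) 1 1 = word_mx s 0 1).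
Proof. by rewrite /= !mulmx2E !mxE /=; do ![split]; ring. Qed.

Lemma word_mx_rconsE a s :
  (word_mx (rcons s a) 0 0 = a * word_mx s 0 0 + word_mx s 0 1) *
  (word_mx (rcons s a) 0 1 = - word_mx s 0 0) *
  (word_mx (rcons s a) 1 0 = a * word_mx s 1 0 + word_mx s 1 1) *
  (word_mx (rcons s a) 1 1 = - word_mx s 1 0).
Proof. by rewrite word_mx_rcons !mulmx2E !mxE /=; do ![split]; ring. Qed.

(** Transposition followed by conjugation with diag(1,-1) reverses products and fixes each
    [letter_mx a]. *)
Lemma word_mx_rev s :
  (word_mx (rev s) 0 0 = word_mx s 0 0) *
  (word_mx (rev s) 0 1 = - word_mx s 1 0) *
  (word_mx (rev s) 1 0 = - word_mx s 0 1) *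
  (word_mx (rev s) 1 1 = word_mx s 1 1).
Proof.
elim: s => [|a s IH]; first by rewrite /= !mxE /=; do ![split].
by rewrite rev_cons !word_mx_rconsE !word_mx_consE !IH; do ![split]; ring.
Qed.

Lemma continuant_mx s : continuant s = word_mx s 0 0.
Proof.
have [n] := ubnP (size s); elim: n => // n IH in s *.
case: s => [|a [|b s]] sn.
- by rewrite mxE.
- by rewrite !word_mx_consE !mxE /continuant /rev /=; ring.
- by rewrite continuant_cons !IH ?word_mx_consE //; last exact: ltnW.
Qed.

Lemma cyclic_continuant_trace s : s <> [::] ->
  cyclic_continuant_seq s = \tr (word_mx s).
Proof.
rewrite mxtrace2; case: s => [//|a [|b s]] _.
  by rewrite /cyclic_continuant_seq !word_mx_consE /= !mxE /=; ring.
rewrite [LHS]/= !continuant_mx word_mx_consE [word_mx _ 1 1]word_mx_consE.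
by rewrite lastI [word_mx _ 0 1]word_mx_rconsE.
Qed.

(* The continuant of [s] without its first letter minus that of [s] without its
   last letter. *)
Definition skew s : int := word_mx s 0 1 + word_mx s 1 0.

Lemma skew_rev s : skew (rev s) = - skew s.
Proof. by rewrite /skew !word_mx_rev; ring. Qed.

Lemma skew_ends a b s :
  skew (a :: rcons s b) = (b - a) * word_mx s 0 0 + skew s.
Proof. by rewrite /skew !word_mx_consE !word_mx_rconsE; ring. Qed.

(** The difference of [word_mx s] and [word_mx (rev s)] is [skew s] times the matrix that swaps the
    coordinates. *)
Lemma trace_rev_cat s t :
  \tr (word_mx (s ++ t)) - \tr (word_mx (rev s ++ t)) = skew s * skew t.
Proof.
by rewrite !mxtrace2 !word_mx_cat !mulmx2E /skew !word_mx_rev; ring.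
Qed.

(** Both the first column and the sum of the columns have an upper entry at least the lower one,
    which is non-negative, respectively at least 1. Left multiplication by [letter_mx a] with
    [2 <= a] preserves this. *)
Lemma word_mx_ge2 s : {in s, forall a, 2 <= a} ->
  [/\ 0 <= word_mx s 1 0, word_mx s 1 0 <= word_mx s 0 0,
      1 <= word_mx s 1 0 + word_mx s 1 1 &
      word_mx s 1 0 + word_mx s 1 1 <= word_mx s 0 0 + word_mx s 0 1].
Proof.
elim: s => [|a s IH] s2; first by rewrite /= !mxE.
have a2 : 2 <= a by apply: s2; rewrite mem_head.
have [|] := IH; first by move=> b bs; apply: s2; rewrite inE bs orbT.
by rewrite !word_mx_consE => h1 h2 h3 h4; split; nia.
Qed.

End ContinuantMatrix.

(** * Minimizers of the continuant under an increasing valuation of the letters *)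

Section Minimizers.
Set Implicit Arguments.
Unset Strict Implicit.
Context {d : Order.disp_t} {A : finOrderType d}.
Variable f : A -> int.
Hypothesis f_mono : {homo f : a b / (a < b)%O >-> (a < b)%R}.
Hypothesis f_ge2 : forall a, (2 <= f a)%R.
Implicit Types (s t : seq A) (x y : cyclic_word A).

Definition cyclic_value x : int :=
  cyclic_continuant_seq (map f (val (cyc_repr x))).

Lemma cyclic_valueE (w : word A) :
  cyclic_value (cyc w) = (\tr (word_mx (map f (val w))))%R.
Proof.
have /asboolP[p [q [e e']]] := conjugate_repr w.
rewrite /cyclic_value cyclic_continuant_trace; last first.
  by case: (cyc_repr _) => -[].
by rewrite e e' !map_cat !word_mx_cat mxtrace_mulC.
Qed.

(** Equal outer letters affect neither the comparison nor [skew] and are stripped. For outer letters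
    [a < b], [skew_ends] and [f b - f a >= 1] reduce the claim to the bounds of [word_mx_ge2]. *)
Lemma skew_gt0 s : ((s : seqlexi A) < (rev s : seqlexi A))%O ->
  (0 < skew (map f s))%R.
Proof.
have [n] := ubnP (size s); elim: n => // n IH in s *.
case: s => [|a s] sn; first by rewrite ltxx.
case/lastP: s sn => [|s b] sn; first by rewrite ltxx.
rewrite rev_cons rev_rcons rcons_cons.
rewrite Order.SeqLexiOrder.ltxi_cons /= map_rcons skew_ends.
have [ab _|//|<-] := ltgtP a b; last first.
  rewrite subrr mul0r add0r lexi_rcons ?size_rev //; apply: IH.
  by move: sn; rewrite /= size_rcons; lia.
have [|h1 h2 h3 h4] := @word_mx_ge2 (map f s).
  by move=> c /mapP[e _ ->].
by have := f_mono ab; rewrite /skew; nia.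
Qed.

Lemma minimizer_unsync (C : set (cyclic_word A)) x : cyclic_abelian_class C ->
  C x -> (forall y, C y -> cyclic_value x <= cyclic_value y)%R -> unsync C x.
Proof.
move=> [p [_ ->]] /= xp xmin; split=> // u v xuv nu nv sync.
(* The sign of [skew] decides the comparison; the negative case is [skew_gt0] for the reversed
   word. *)
have prt (w : word A) : w <> rev_word w -> skew (map f (val w)) != 0%R /\
   ((0 < skew (map f (val w)))%R <-> lex_lt w (rev_word w)).
  rewrite /lex_lt => nw.
  have [lw|gw|wE] := ltgtP (val w : seqlexi A) (val (rev_word w)).
  - by have h := skew_gt0 lw; split; first exact: lt0r_neq0.
  - have : (0 < skew (map f (rev (val w))))%R by apply: skew_gt0; rewrite revK.
    by rewrite map_rev skew_rev => h; split; [lia|split; lia].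
  - by case: nw; apply: val_inj.
have [[u0 uE] [v0 vE]] := (prt u nu, prt v nv).
have uv : (0 < skew (map f (val u)))%R <-> (0 < skew (map f (val v)))%R.
  by move: sync; rewrite /synchronizing; tauto.
have uv0 : (0 < skew (map f (val u)) * skew (map f (val v)))%R.
  by move: u0 v0 uv; case: ltgtP => // u0 _; case: ltgtP => // v0 _ [h1 h2];
    [nia|by have := h1 isT|by have := h2 isT|nia].
(* The word [rev u ++ v] has the same letters and would have a value below the minimum. *)
move: uv0; rewrite -trace_rev_cat subr_gt0 -map_rev -!map_cat.
rewrite -[rev (val u) ++ _]/(val (cat_word (rev_word u) v)).
rewrite -[val u ++ _]/(val (cat_word u v)) -!cyclic_valueE -xuv ltNge xmin //.
by rewrite -xp; apply/funext => c; rewrite xuv !parikhE /= !count_cat count_rev.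
Qed.

(** Minimizing over the tuples that permute one word [s0] of the class makes the search finite. *)
Lemma minimizer_exists (C : set (cyclic_word A)) : cyclic_abelian_class C ->
  exists x, C x /\ forall y, C y -> (cyclic_value x <= cyclic_value y)%R.
Proof.
move=> [p [[a pa] ->]].
pose s0 := flatten [seq nseq (p b) b | b <- enum A].
have cs0 b : count_mem b s0 = p b.
  rewrite count_flatten sumnE -map_comp big_map big_enum (bigD1 b) //= big1.
    by rewrite count_nseq /= eqxx mul1n addn0.
  by move=> c /negPf cb; rewrite count_nseq /= cb.
have s0n : s0 != [::] by apply: contra_notN pa => /eqP e; rewrite -cs0 e.
pose n := size s0.
pose F (t : n.-tuple A) := (\tr (word_mx (map f t)))%R.
have [t st tmin] := @arg_minP _ _ _ (in_tuple s0) (perm_eq s0) F (perm_refl _).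
have tn : val t != [::].
  apply: contraNneq s0n => t0.
  by rewrite -size_eq0 (perm_size st) size_eq0; apply/eqP.
pose T : word A := exist (fun s : seq A => s != [::]) (val t) tn.
exists (cyc T); split=> [|y yp].
  by apply/funext => b; rewrite parikhE -cs0; apply/esym/permP.
rewrite -(cyc_reprK y) !cyclic_valueE.
set w := val (cyc_repr y).
have sw : perm_eq s0 w.
  by apply/allP => b _ /=; rewrite cs0 -yp.
have wn : size w == n by rewrite -(perm_size sw).
exact: (tmin (Tuple wn)).
Qed.
End Minimizers.

(** * Counting symmetric classes and identifying minimizers *)

Lemma unsync_bar {d : Order.disp_t} {A : finOrderType d}
    {C : set (cyclic_word A)} {x y} :
  cyclic_abelian_class C -> unsync C x -> unsync C y -> bar x = bar y.
Proof.
move=> [p [_ ->]] [/= xp dx] [/= yp dy]; apply: desync_unique => //.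
by rewrite xp yp.
Qed.

Theorem proposition3p11 :
  (forall (d : Order.disp_t) (A : finOrderType d)
      (X : set (set (cyclic_word A))),
    symmetric_cyclic_abelian_class X -> unsync_sym X #= `I_1) /\
  (forall (S : {fset nat}), (forall a, a \in S -> 2 <= a) ->
    forall (C : set (cyclic_word S)), cyclic_abelian_class C ->
    exists x, is_minimizer C x /\ forall y, is_minimizer C y -> bar x y).
Proof.
split=> [d A X [C [hC ->]]|S S2 C hC].
  rewrite unsync_symE //.
  (* The rank of a letter plus 2, the simplest increasing valuation with values at least 2. *)
  pose f (a : A) : int := #|[pred b : A | (b < a)%O]|.+2.
  have f_mono : {homo f : a b / (a < b)%O >-> (a < b)%R}.
    move=> a b ab; rewrite ltz_nat !ltnS; apply/proper_card/properP; split.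
      by apply/fintype.subsetP => c; rewrite !inE => /lt_trans; apply.
    by exists a; rewrite !inE ?ltxx.
  have f_ge2 a : (2 <= f a)%R by [].
  have [x [Cx xmin]] := minimizer_exists f hC.
  have ux := minimizer_unsync f_mono f_ge2 hC Cx xmin.
  suff -> : [set bar y | y in unsync C] = [set bar x] by exact: card_set1.
  apply/seteqP; split=> [_ [y uy <-]|_ ->] /=; last by exists x.
  exact: (unsync_bar hC).
(* With the inclusion as valuation, [cyclic_value f] unfolds to [cyclic_continuant]. *)
pose f (a : S) : int := val a.
have f_mono : {homo f : a b / (a < b)%O >-> (a < b)%R}.
  by move=> a b; rewrite ltz_nat.
have f_ge2 a : (2 <= f a)%R by rewrite lez_nat S2 // (valP a).
have [x [Cx xmin]] := minimizer_exists f hC.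
exists x; split=> // y [Cy ymin].
have ux := minimizer_unsync f_mono f_ge2 hC Cx xmin.
have uy := minimizer_unsync f_mono f_ge2 hC Cy ymin.
by rewrite (unsync_bar hC ux uy); left.
Qed.
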